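(* Let $\mathfrak{g}=\mathfrak{h}\rtimes_D\mathbb{R}$ be a four-dimensional almost abelian real Lie algebra with basis $\{e_1,e_2,e_3,e_4\}$, $\mathfrak{h}=\mathrm{span}_{\mathbb R}\{e_1,e_2,e_3\}$, $D=\mathrm{ad}(e_4)|_{\mathfrak{h}}$, with metric $g=e^1\otimes e^1+e^2\otimes e^2-e^3\otimes e^3-e^4\otimes e^4$, and suppose that $$D=\begin{pmatrix} d_{11}&d_{12}&d_{12}\\ d_{21}&d_{22}&-d_{11}+d_{22}\\ -d_{21}&d_{32}&d_{11}+d_{32}\end{pmatrix},$$ $$\varphi=\varphi_1e^1+\varphi_2(e^2+e^3)+(\varphi_1+d_{11}+d_{22}+d_{32})e^4,$$ $$H=2d_{11}e^{123}-(d_{12}+d_{21})(e^{124}+e^{134})+(d_{11}-d_{22}-d_{32})e^{234},$$ with real parameters satisfying $d_{11}\mathrm{Tr}(D)=0$, $d_{11}\varphi_1=0$, $d_{12}\varphi_1+(d_{22}+d_{32})\varphi_2=0$. Assume that $\mathfrak{g}$ is unimodular and that $\varphi$ and $H$ are non-zero. Then $(\mathfrak{g},g,\varphi,H)$ solves $$\mathrm{Ric}^g+\nabla^g\varphi-\tfrac12H\circ H=0,\qquad \delta H+\iota_{\varphi^\sharp}H=0,\qquad \delta\varphi+\langle\varphi,\varphi\rangle-\langle H,H\rangle=0$$ if and only if $$D=\begin{pmatrix}0&0&0\\ d_{21}&d_{22}&d_{22}\\ -d_{21}&-d_{22}&-d_{22}\end{pmatrix},\qquad \varphi=\varphi_2(e^2+e^3),\qquad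 H=-d_{21}(e^{124}+e^{134})=\mathrm{d}(e^{23})$$ with $\varphi_2$ and $d_{21}$ non-zero. In particular, in that case $\mathfrak{g}\cong\mathbb{R}\oplus\mathfrak{heis}_3$, where $\mathfrak{heis}_3$ is the three-dimensional Heisenberg Lie algebra.
   Context: Almost abelian: $\mathfrak{g}$ is non-abelian with codimension-one abelian ideal $\mathfrak{h}$. Brackets: $[e_i,e_j]=0$, $[e_4,e_i]=De_i=d_{1i}e_1+d_{2i}e_2+d_{3i}e_3$ for $i,j\in\{1,2,3\}$, $D=(d_{ij})$. $\mathfrak{g}$ is unimodular iff $\mathrm{Tr}(D)=0$. $\{e^i\}$ is the dual basis, $e^{ab\cdots}=e^a\wedge e^b\wedge\cdots$, $\mathrm{d}$ is the Chevalley-Eilenberg differential ($\mathrm{d}\theta(X,Y)=-\theta([X,Y])$). All objects are regarded as left-invariant objects on the simply connected Lie group of $\mathfrak{g}$, oriented by $e^{1234}$. $\nabla^g$ is the Levi-Civita connection, $\mathrm{Ric}^g$ the Ricci tensor, $\langle-,-\rangle$ the metric induced by $g$ on forms (determinant convention on decomposables), $(H\circ H)(X,Y)=\langle\iota_XH,\iota_YH\rangle$, $\delta=-*\mathrm{d}*$ the codifferential with $\beta\wedge*\gamma=\langle\beta,\gamma\rangle e^{1234}$, and $\varphi^\sharp$ the $g$-dual vector of $\varphi$. *)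

(* Defs.v *)
From HB Require Import structures.
From HB Require Import structures.
From mathcomp Require Import all_boot all_order all_fingroup all_algebra.
From mathcomp Require Import ring.

#[local] Obligation Tactic := idtac.

Set Implicit Arguments.
Unset Strict Implicit.
Unset Printing Implicit Defensive.

Import Order.TTheory GRing.Theory Num.Theory.
Local Open Scope ring_scope.

(* A left-invariant object on a simply connected Lie group is the same thing  *)
(* as the corresponding object on its Lie algebra, so everything below lives  *)
(* on a Lie algebra, whose underlying vector space is 'rV[R]_n.               *)

Section LieAlgebras.
Variable R : realFieldType.

Record lieAlgebra n := LieAlgebra {
  bracket :> 'rV[R]_n -> 'rV[R]_n -> 'rV[R]_n;
  _ : forall x, linear (bracket x);
  _ : forall y, linear (bracket^~ y);
  _ : forall x, bracket x x = 0;
  _ : forall x y z, bracket x (bracket y z) + bracket y (bracket z x)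
                      + bracket z (bracket x y) = 0
}.

Definition abelian_lie n (L : lieAlgebra n) := forall x y, L x y = 0.

(* Subspaces of 'rV_n are row spaces of matrices. *)
Definition almost_abelian n (L : lieAlgebra n) :=
  ~ abelian_lie L /\
  exists h : 'M[R]_n,
    [/\ (\rank h).+1 = n,
        forall x y, (x <= h)%MS -> (y <= h)%MS -> L x y = 0 &
        forall x y, (y <= h)%MS -> (L x y <= h)%MS].

Definition unimodular n (L : lieAlgebra n) :=
  forall x, \tr (lin1_mx (L x)) = 0.

Definition lie_iso m n (L : lieAlgebra m) (L' : lieAlgebra n) :=
  exists f : 'rV[R]_m -> 'rV[R]_n,
    [/\ linear f, bijective f & forall x y, f (L x y) = L' (f x) (f y)].

Definition abelian_bracket n (x y : 'rV[R]_n) : 'rV[R]_n := 0.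

Program Definition abelian_lieAlgebra n : lieAlgebra n :=
  @LieAlgebra n (@abelian_bracket n) _ _ _ _.
Next Obligation. by move=> n x a u v; rewrite /abelian_bracket scaler0 addr0. Qed.
Next Obligation. by move=> n x a u v; rewrite /abelian_bracket scaler0 addr0. Qed.
Next Obligation. by []. Qed.
Next Obligation. by move=> n x y z; rewrite /abelian_bracket !addr0. Qed.

(* R^n ><|_D R: vectors of R^n are rows, hence D v is written v *m D^T, and   *)
(* the last basis vector acts on R^n by D.                                    *)
Definition semidirect_bracket n (D : 'M[R]_n) (x y : 'rV[R]_(n + 1)) :
    'rV[R]_(n + 1) :=
  row_mx ((rsubmx x 0 0 *: lsubmx y - rsubmx y 0 0 *: lsubmx x) *m D^T) 0.

Program Definition semidirect n (D : 'M[R]_n) : lieAlgebra (n + 1) :=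
  @LieAlgebra _ (semidirect_bracket D) _ _ _ _.
Next Obligation.
move=> n D x a u v; rewrite /semidirect_bracket scale_row_mx add_row_mx.
rewrite scaler0 addr0; congr row_mx; rewrite scalemxAl -mulmxDl; congr (_ *m _).
by apply/rowP=> j; rewrite !mxE; ring.
Qed.
Next Obligation.
move=> n D x a u v; rewrite /semidirect_bracket scale_row_mx add_row_mx.
rewrite scaler0 addr0; congr row_mx; rewrite scalemxAl -mulmxDl; congr (_ *m _).
by apply/rowP=> j; rewrite !mxE; ring.
Qed.
Next Obligation.
by move=> n D x; rewrite /semidirect_bracket subrr mul0mx row_mx0.
Qed.
Next Obligation.
move=> n D x y z; rewrite /semidirect_bracket !row_mxKl !row_mxKr.
rewrite !add_row_mx !addr0 -[RHS]row_mx0; congr row_mx.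
rewrite !mxE !scale0r !subr0 -!mulmxDl; set A := (X in X *m _ = _).
suff -> : A = 0 by rewrite mul0mx.
rewrite /A !scalemxAl -!mulmxDl; set B := (X in X *m _ = _).
suff -> : B = 0 by rewrite mul0mx.
by apply/rowP=> j; rewrite !mxE; ring.
Qed.

Definition direct_sum_bracket m n (L : lieAlgebra m) (L' : lieAlgebra n)
    (x y : 'rV[R]_(m + n)) : 'rV[R]_(m + n) :=
  row_mx (L (lsubmx x) (lsubmx y)) (L' (rsubmx x) (rsubmx y)).

Program Definition direct_sum m n (L : lieAlgebra m) (L' : lieAlgebra n) :
    lieAlgebra (m + n) :=
  @LieAlgebra _ (direct_sum_bracket L L') _ _ _ _.
Next Obligation.
move=> m n [b Hr ? ? ?] [b' Hr' ? ? ?] x a u v; rewrite /direct_sum_bracket /=.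
by rewrite !linearP Hr Hr' scale_row_mx add_row_mx.
Qed.
Next Obligation.
move=> m n [b ? Hl ? ?] [b' ? Hl' ? ?] x a u v; rewrite /direct_sum_bracket /=.
by rewrite !linearP Hl Hl' scale_row_mx add_row_mx.
Qed.
Next Obligation.
move=> m n [b ? ? Ha ?] [b' ? ? Ha' ?] x; rewrite /direct_sum_bracket /=.
by rewrite Ha Ha' row_mx0.
Qed.
Next Obligation.
move=> m n [b ? ? ? HJ] [b' ? ? ? HJ'] x y z; rewrite /direct_sum_bracket /=.
by rewrite !row_mxKl !row_mxKr !add_row_mx HJ HJ' row_mx0.
Qed.

Definition heis3_bracket (x y : 'rV[R]_3) : 'rV[R]_3 :=
  let i0 : 'I_3 := @Ordinal 3 0 isT in
  let i1 : 'I_3 := @Ordinal 3 1 isT in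
  let i2 : 'I_3 := @Ordinal 3 2 isT in
  (x 0 i0 * y 0 i1 - x 0 i1 * y 0 i0) *: delta_mx 0 i2.

Program Definition heis3 : lieAlgebra 3 :=
  @LieAlgebra _ heis3_bracket _ _ _ _.
Next Obligation.
by move=> x a u v; rewrite /heis3_bracket scalerA -scalerDl !mxE; congr (_ *: _); ring.
Qed.
Next Obligation.
by move=> x a u v; rewrite /heis3_bracket scalerA -scalerDl !mxE; congr (_ *: _); ring.
Qed.
Next Obligation.
by move=> x; rewrite /heis3_bracket mulrC subrr scale0r.
Qed.
Next Obligation.
by move=> x y z; rewrite /heis3_bracket -!scalerDl !mxE /= !mulr0 !subrr !addr0 scale0r.
Qed.

End LieAlgebras.

Section PseudoRiemannian.
Variables (R : realFieldType) (n : nat) (L : lieAlgebra R n).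

(* G is the Gram matrix of the metric in the standard basis. *)
Definition metric (G : 'M[R]_n) (x y : 'rV[R]_n) : R := (x *m G *m y^T) 0 0.

(* On left-invariant fields g(Y, Z) is constant, so X(g(Y, Z)) = 0. *)
Definition levi_civita (G : 'M[R]_n)
    (nabla : 'rV[R]_n -> 'rV[R]_n -> 'rV[R]_n) : Prop :=
  [/\ forall x, linear (nabla x),
      forall y, linear (nabla^~ y),
      forall x y, nabla x y - nabla y x = L x y &
      forall x y z, metric G (nabla x y) z + metric G y (nabla x z) = 0].

Definition curvature (nabla : 'rV[R]_n -> 'rV[R]_n -> 'rV[R]_n) x y z :=
  nabla x (nabla y z) - nabla y (nabla x z) - nabla (L x y) z.

Definition ricci nabla x y : R :=
  \tr (lin1_mx (fun z => curvature nabla z x y)).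

End PseudoRiemannian.

Section Forms.
Variables (R : realFieldType) (n : nat).

(* A k-form is evaluated on the k rows of a matrix. *)
Definition kform k := 'M[R]_(k, n) -> R.

Definition multilinear k (w : kform k) :=
  forall (A B C : 'M[R]_(k, n)) i b c,
    row i A = b *: row i B + c *: row i C ->
    row' i B = row' i A -> row' i C = row' i A ->
    w A = b * w B + c * w C.

Definition alternating k (w : kform k) :=
  multilinear w /\
  forall A i j, i != j -> row i A = row j A -> w A = 0.

Definition dual_form (i : 'I_n) : kform 1 := fun x => x 0 i.

Definition wedge p q (a : kform p) (b : kform q) : kform (p + q) := fun X =>
  (p`!%:R * q`!%:R)^-1 *
  \sum_(s : 'S_(p + q))
     (-1) ^+ s * (a (usubmx (row_perm s X)) * b (dsubmx (row_perm s X))).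

Definition contraction k (x : 'rV[R]_n) (w : kform k.+1) : kform k :=
  fun Y => w (col_mx x Y).

(* (d w)(X_0, .., X_k) =                                                      *)
(*   \sum_(i < j) (-1)^(i + j) w([X_i, X_j], X_0, .. without X_i, X_j .., X_k)*)
(* where the larger index is written lift i j = j.+1 with i <= j.             *)
Definition chevalley_eilenberg (L : lieAlgebra R n) k (w : kform k.+1) :
    kform k.+2 := fun X =>
  \sum_(i < k.+2) \sum_(j < k.+1 | (i <= j)%N)
    (-1) ^+ (i + lift i j) *
    w (col_mx (L (row i X) (row (lift i j) X)) (row' j (row' i X))).

Definition increasing k (I : 'I_k -> 'I_n) :=
  [forall a : 'I_k, forall b : 'I_k, (a < b)%N ==> (I a < I b)%N].

(* (e_{I 0}, .., e_{I (k - 1)}) *)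
Definition frame k (I : 'I_k -> 'I_n) : 'M[R]_(k, n) := rowsub I 1%:M.

(* <e^I, e^J> = det (<e^{I a}, e^{J b}>), extended bilinearly from the basis  *)
(* of k-forms e^I, I increasing.                                              *)
Definition form_inner (G : 'M[R]_n) k (a b : kform k) : R :=
  \sum_(I : {ffun 'I_k -> 'I_n} | increasing I)
  \sum_(J : {ffun 'I_k -> 'I_n} | increasing J)
     a (frame I) * b (frame J) * \det (mxsub I J (invmx G)).

Definition sharp (G : 'M[R]_n) (phi : kform 1) : 'rV[R]_n :=
  (\row_i phi (delta_mx 0 i)) *m invmx G.

(* star c (Y) = <vol(-, Y), c>, vol = e^{1..n} = \det; wedge_hodge below      *)
(* shows that this is the star defined by b /\ star c = <b, c> vol.            *)
Definition hodge (G : 'M[R]_n) p q (Epq : (p + q = n)%N) (c : kform p) :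
    kform q := fun Y =>
  form_inner G (fun X => \det (castmx (Epq, erefl n) (col_mx X Y))) c.

Lemma codiff_subproof p q : (p.+1 + q.+1 = n -> q.+2 + p = n)%N.
Proof. by move=> <-; rewrite !addSn !addnS addnC. Qed.

Definition codifferential (L : lieAlgebra R n) (G : 'M[R]_n) p q
    (Epq : (p.+1 + q.+1 = n)%N) (w : kform p.+1) : kform p := fun X =>
  - hodge G (codiff_subproof Epq)
      (chevalley_eilenberg L (hodge G Epq w)) X.

(* (nabla_x phi)(y); the term x(phi(y)) vanishes on left-invariant objects. *)
Definition covariant_derivative (nabla : 'rV[R]_n -> 'rV[R]_n -> 'rV[R]_n)
    (phi : kform 1) (x y : 'rV[R]_n) : R := - phi (nabla x y).

Definition form_circ (G : 'M[R]_n) k (w : kform k.+1) (x y : 'rV[R]_n) : R :=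
  form_inner G (contraction x w) (contraction y w).

End Forms.

Notation "a \wedge b" := (wedge a b) (at level 40, left associativity) : ring_scope.

Section Hodge.
Variable R : realFieldType.

Section Alternating.
Variables (n k : nat) (w : kform R n k).
Hypothesis alt_w : alternating w.

Let subrow (A : 'M[R]_(k, n)) i j (x y : 'rV[R]_n) : 'M[R]_(k, n) :=
  \matrix_(a, c) if a == i then x 0 c else if a == j then y 0 c else A a c.

Lemma alternating_tperm i j A : i != j ->
  w (row_perm (tperm i j) A) = - w A.
Proof.
have [lin alt] := alt_w => nij.
pose F := subrow A i j.
have Fxx x : w (F x x) = 0.
  by apply: (alt _ i j) => //; apply/rowP=> c; rewrite !mxE !eqxx; case: ifP.
have Fl x y z : w (F (x + y) z) = w (F x z) + w (F y z).
  rewrite (lin _ (F x z) (F y z) i 1 1) ?mul1r //.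
  - by apply/rowP=> c; rewrite !mxE eqxx !mul1r.
  - by apply/matrixP=> a c; rewrite !mxE eq_sym (negPf (neq_lift _ _)).
  - by apply/matrixP=> a c; rewrite !mxE eq_sym (negPf (neq_lift _ _)).
have Fr x y z : w (F x (y + z)) = w (F x y) + w (F x z).
  rewrite (lin _ (F x y) (F x z) j 1 1) ?mul1r //.
  - by apply/rowP=> c; rewrite !mxE eqxx eq_sym (negPf nij) !mul1r.
  - by apply/matrixP=> a c; rewrite !mxE [_ == j]eq_sym (negPf (neq_lift _ _)).
  - by apply/matrixP=> a c; rewrite !mxE [_ == j]eq_sym (negPf (neq_lift _ _)).
have FA : F (row i A) (row j A) = A.
  apply/matrixP=> a c; rewrite !mxE.
  by case: eqP => [-> //|_]; case: eqP => [-> //|_].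
have FB : F (row j A) (row i A) = row_perm (tperm i j) A.
  apply/matrixP=> a c; rewrite !mxE.
  case: eqP => [->|/eqP nai]; first by rewrite tpermL.
  case: eqP => [->|/eqP naj]; first by rewrite tpermR.
  by rewrite tpermD // eq_sym.
have := Fxx (row i A + row j A).
rewrite Fl !Fr !Fxx add0r addr0 FA FB => /eqP.
by rewrite addrC addr_eq0 => /eqP.
Qed.

Lemma alternating_perm (t : 'S_k) A :
  w (row_perm t A) = (-1) ^+ t * w A.
Proof.
have [ts -> nts] := prod_tpermP t.
elim: ts nts A => [|[i j] ts IH] /= nts A.
  by rewrite big_nil odd_perm1 expr0 mul1r row_perm1.
case/andP: nts => nij nts.
rewrite big_cons row_permM alternating_tperm // IH //.
by rewrite odd_permM odd_tperm nij signr_addb expr1 mulN1r mulNr.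
Qed.

End Alternating.

Section BlockPerm.
Variables (p q : nat) (t : 'S_p) (u : 'S_q).

Let bfun (k : 'I_(p + q)) : 'I_(p + q) :=
  match split k with inl a => lshift q (t a) | inr b => rshift p (u b) end.

Let bfun_inj : injective bfun.
Proof.
move=> k l; rewrite /bfun.
case: (split_ordP k) => a ->; case: (split_ordP l) => b ->.
- by move/lshift_inj/perm_inj->.
- by move/eqP; rewrite eq_lrshift.
- by move/eqP; rewrite eq_rlshift.
- by move/rshift_inj/perm_inj->.
Qed.

Lemma block_permP : {w : 'S_(p + q) |
  [/\ (forall a, w (lshift q a) = lshift q (t a)),
      (forall b, w (rshift p b) = rshift p (u b)) &
      (-1) ^+ w = (-1) ^+ t * (-1) ^+ u :> R]}.
Proof.
exists (perm bfun_inj).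
have Wl a : perm bfun_inj (lshift q a) = lshift q (t a).
  by rewrite permE /bfun -[lshift q a]/(unsplit (inl a)) unsplitK.
have Wr b : perm bfun_inj (rshift p b) = rshift p (u b).
  by rewrite permE /bfun -[rshift p b]/(unsplit (inr b)) unsplitK.
split=> //; rewrite -!det_perm -(det_ublock _ 0); congr (\det _).
apply/matrixP=> i j; rewrite [LHS]mxE.
case: (split_ordP i) => a ->; case: (split_ordP j) => b ->;
  rewrite ?Wl ?Wr ?(block_mxEul, block_mxEur, block_mxEdl, block_mxEdr) !mxE ?eq_shift //.
Qed.

End BlockPerm.

Lemma laplace p q (M : 'M[R]_(p + q)) :
  \sum_(s : 'S_(p + q)) (-1) ^+ s *
    (\det (ulsubmx (row_perm s M)) * \det (drsubmx (row_perm s M)))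
  = p`!%:R * q`!%:R * \det M.
Proof.
have E (t : 'S_p) (u : 'S_q) :
    \sum_(s : 'S_(p + q)) (-1) ^+ s *
      (((-1) ^+ t * \prod_a ulsubmx (row_perm s M) a (t a)) *
       ((-1) ^+ u * \prod_b drsubmx (row_perm s M) b (u b))) = \det M.
  have [w [Wl Wr Ws]] := block_permP t u.
  rewrite (reindex_inj (inj_comp (mulgI w) (@invg_inj _))) /=.
  apply: eq_bigr => s _; rewrite mulrACA -Ws [LHS]mulrA -signr_addb.
  rewrite odd_permM odd_permV addbAC addbb addFb; congr (_ * _).
  rewrite [RHS](reindex_inj (@perm_inj _ (w * s^-1)%g)) /= big_split_ord /=.
  by congr (_ * _); apply: eq_bigr => a _; rewrite !mxE; congr (M _ _);
    rewrite -permM mulgKV ?Wl ?Wr.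
transitivity (\sum_(t : 'S_p) \sum_(u : 'S_q) \det M).
  rewrite (eq_bigr (fun s : 'S_(p + q) => \sum_(t : 'S_p) \sum_(u : 'S_q)
      (-1) ^+ s *
      (((-1) ^+ t * \prod_a ulsubmx (row_perm s M) a (t a)) *
       ((-1) ^+ u * \prod_b drsubmx (row_perm s M) b (u b))))).
    rewrite exchange_big; apply: eq_bigr => t _.
    by rewrite exchange_big; apply: eq_bigr => u _; rewrite E.
  move=> s _; rewrite mulr_suml mulr_sumr; apply: eq_bigr => t _.
  by rewrite mulr_sumr mulr_sumr; apply: eq_bigr.
by rewrite !sumr_const !card_Sn -mulrnA -natrM mulr_natl mulnC.
Qed.

(* Agreement of wedge with the determinant convention for the e^I. *)
Lemma wedge_det n p q (I : 'I_p -> 'I_n) (J : 'I_q -> 'I_n) (X : 'M[R]_(p + q, n)) :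
  wedge (fun Y => \det (colsub I Y)) (fun Y => \det (colsub J Y)) X =
  \det (row_mx (colsub I X) (colsub J X)).
Proof.
rewrite /wedge; set M := row_mx _ _.
rewrite (eq_bigr (fun s : 'S_(p + q) => (-1) ^+ s *
    (\det (ulsubmx (row_perm s M)) * \det (drsubmx (row_perm s M))))).
  by rewrite laplace mulKf // mulf_neq0 // pnatr_eq0 -lt0n fact_gt0.
move=> s _; congr (_ * _); congr (_ * _); congr (\det _).
  by apply/matrixP=> a b; rewrite !mxE (unsplitK (inl b)) mxE.
by apply/matrixP=> a b; rewrite !mxE (unsplitK (inr b)) mxE.
Qed.

Section WedgeHodge.
Variables p q : nat.

Lemma extend_inj (I : 'I_p -> 'I_(p + q)) : injective I ->
  {u : 'S_(p + q) | forall a, u (lshift q a) = I a}.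
Proof.
move=> injI; pose C := ~: [set I a | a : 'I_p].
have cC : #|C| = q.
  have := cardsC [set I a | a : 'I_p].
  by rewrite card_imset // !card_ord => /addnI.
pose f k := match split k with inl a => I a
                             | inr b => enum_val (cast_ord (esym cC) b) end.
have nI a b : I a != enum_val (cast_ord (esym cC) b).
  have := enum_valP (cast_ord (esym cC) b); rewrite inE.
  by apply: contra => /eqP <-; apply: imset_f.
have injf : injective f.
  move=> k l; rewrite /f.
  case: (split_ordP k) => a ->; case: (split_ordP l) => b ->.
  - by move/injI->.
  - by move/eqP; rewrite (negPf (nI _ _)).
  - by move/eqP; rewrite eq_sym (negPf (nI _ _)).
  - by move/enum_val_inj/cast_ord_inj->.
exists (perm injf) => a.
by rewrite permE /f -[lshift q a]/(unsplit (inl a)) unsplitK.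
Qed.

Lemma wedge_hodge_aux (b : kform R (p + q) p) (I : 'I_p -> 'I_(p + q)) :
  alternating b -> injective I ->
  \sum_(s : 'S_(p + q)) (-1) ^+ s *
    (b (usubmx (row_perm s 1%:M)) *
     \det (col_mx (frame R I) (dsubmx (row_perm s 1%:M))))
  = p`!%:R * q`!%:R * b (frame R I).
Proof.
move=> alt_b injI; have [u uI] := extend_inj injI.
have frameE : frame R I = usubmx (perm_mx u).
  by apply/matrixP=> a c; rewrite !mxE uI.
have -> : p`!%:R * q`!%:R * b (frame R I)
    = (p`!%:R * q`!%:R * \det (1%:M : 'M[R]_(p + q))) * b (frame R I).
  by rewrite det1 mulr1.
rewrite -laplace mulr_suml (reindex_inj (mulIg u)) /=.
apply: eq_bigr => s _; rewrite odd_permM signr_addb.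
rewrite -![row_perm _ 1%:M]/(perm_mx _) perm_mxM.
set P := perm_mx s; set U := perm_mx u.
have -> : dsubmx (P *m U) = dsubmx P *m U by rewrite mul_dsub_mx.
have -> : usubmx (P *m U) = usubmx P *m U by rewrite mul_usub_mx.
have -> : col_mx (frame R I) (dsubmx P *m U)
       = block_mx 1%:M 0 (dlsubmx P) (drsubmx P) *m U.
  rewrite block_mxEv mul_col_mx frameE; congr col_mx.
    by rewrite -[U in RHS]vsubmxK mul_row_col mul1mx mul0mx addr0.
  by rewrite /dlsubmx /drsubmx hsubmxK.
rewrite det_mulmx det_lblock det1 mul1r [\det U]det_perm.
have [D0|Dn0] := eqVneq (\det (drsubmx P)) 0; first by rewrite D0 !(mul0r, mulr0).
have sr c : exists d, s (rshift p c) = rshift p d.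
  case: (split_ordP (s (rshift p c))) => d Ed; last by exists d.
  case/eqP: Dn0; rewrite (expand_det_row _ c) big1 // => d' _.
  by rewrite !mxE Ed eq_lrshift mul0r.
have srT : [set s k | k in [set rshift p c | c : 'I_q]] = [set rshift p c | c : 'I_q].
  apply/eqP; rewrite eqEcard (card_imset _ (@perm_inj _ s)) leqnn andbT.
  apply/subsetP=> _ /imsetP[_ /imsetP[c _ ->] ->].
  by have [d ->] := sr c; apply: imset_f.
have sl a : {d | s (lshift q a) = lshift q d}.
  case: (split_ordP (s (lshift q a))) => d Ed; first by exists d.
  have : s (lshift q a) \in [set s k | k in [set rshift p c | c : 'I_q]].
    by rewrite srT Ed imset_f.
  case/imsetP/sig2_eqW => k.
  by case/imsetP/sig2_eqW => c _ ->; move=> /perm_inj/eqP; rewrite eq_lrshift.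
pose t0 a := sval (sl a).
have t0E a : s (lshift q a) = lshift q (t0 a) by rewrite /t0; case: (sl a).
have injt : injective t0.
  by move=> a c E; apply: (@lshift_inj _ q); apply: (@perm_inj _ s); rewrite !t0E E.
pose t := perm injt.
have -> : usubmx P *m U = row_perm t (frame R I).
  rewrite frameE mul_usub_mx -perm_mxM; apply/matrixP=> a c.
  by rewrite !mxE !permM t0E permE.
rewrite (alternating_perm alt_b).
have -> : ulsubmx P = perm_mx t.
  by apply/matrixP=> a c; rewrite !mxE t0E permE eq_shift.
rewrite det_perm.
have uu : (-1) ^+ u * (-1) ^+ u = 1 :> R by rewrite -signr_addb addbb.
move: ((-1) ^+ u) uu => x xx; move: ((-1) ^+ s) ((-1) ^+ t) => y z.
rewrite -[RHS]mul1r -xx; ring.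
Qed.

(* b /\ star c = <b, c> e^{1..n}, evaluated at (e_1, .., e_n). *)
Lemma wedge_hodge (G : 'M[R]_(p + q)) (b c : kform R (p + q) p) :
  alternating b ->
  wedge b (hodge G (erefl (p + q)%N) c) 1%:M = form_inner G b c.
Proof.
move=> alt_b; rewrite /wedge /form_inner.
have fact_neq0 : p`!%:R * q`!%:R != 0 :> R.
  by rewrite mulf_neq0 // pnatr_eq0 -lt0n fact_gt0.
apply: (mulfI fact_neq0); rewrite mulVKf // mulr_sumr.
under eq_bigr => s _ do rewrite /hodge /form_inner mulrA mulr_sumr.
rewrite exchange_big; apply: eq_bigr => I incI /=.
under eq_bigr => s _ do rewrite mulr_sumr.
rewrite exchange_big mulr_sumr; apply: eq_bigr => J incJ /=.
rewrite !mulrA -wedge_hodge_aux //; last first.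
  move=> x y E; apply/eqP; case: (ltngtP x y) => // lt_xy.
  - have := forallP (forallP incI x) y; by rewrite lt_xy E ltnn.
  - have := forallP (forallP incI y) x; by rewrite lt_xy E ltnn.
- by apply/eqP/val_inj.
rewrite !mulr_suml; apply: eq_bigr => s _.
by rewrite castmx_id !mulrA.
Qed.

End WedgeHodge.
End Hodge.

Section MetricFacts.
Variables (R : realFieldType) (n : nat) (L : lieAlgebra R n) (G : 'M[R]_n).
Hypotheses (symG : G^T = G) (unitG : G \in unitmx).

Let g := metric G.

Let g_sym x y : g x y = g y x.
Proof.
rewrite /g /metric; transitivity ((x *m G *m y^T)^T 0 0); first by rewrite [RHS]mxE.
by rewrite !trmx_mul trmxK symG mulmxA.
Qed.

Let g_linear x : scalar (g x).
Proof.
by move=> a u v; rewrite /g /metric linearP mulmxDr -scalemxAr !mxE.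
Qed.

Let g_nondeg x y : (forall z, g x z = g y z) -> x = y.
Proof.
move=> gxy; apply/(can_inj (mulmxK unitG))/rowP=> j.
have := gxy (delta_mx 0 j).
by rewrite /g /metric trmx_delta -!colE !mxE.
Qed.

Lemma sharpE (phi : kform R n 1) y : scalar phi -> metric G (sharp G phi) y = phi y.
Proof.
move=> lphi; pose lphi' := GRing.isLinear.Build _ _ _ _ phi lphi.
pose f : {linear 'rV[R]_n -> R^o} := HB.pack phi lphi'.
rewrite /metric /sharp mulmxKV // mxE [y in RHS]row_sum_delta.
rewrite -[phi _]/(f _) linear_sum; apply: eq_bigr => i _.
by rewrite linearZ !mxE mulrC.
Qed.

Lemma levi_civita_exists : exists nabla, levi_civita L G nabla.
Proof.
case: L => b br bl ba bj.
have banti x y : b x y = - b y x.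
  have bD u v w : b u (v + w) = b u v + b u w.
    by have := br u 1 v w; rewrite !scale1r.
  have bD' u v w : b (u + v) w = b u w + b v w.
    by have := bl w 1 u v; rewrite !scale1r.
  apply/eqP; rewrite -addr_eq0; have := ba (x + y).
  by rewrite bD !bD' !ba add0r addr0 addrC => ->.
pose K x y z := 2^-1 * (g (b x y) z - g (b y z) x + g (b z x) y).
pose nabla x y := sharp G (K x y).
have Kl x y : scalar (K x y).
  by move=> a u v; rewrite /K (br y) (bl x) !(g_sym _ x) !(g_sym _ y) !g_linear; field.
have gn x y z : g (nabla x y) z = K x y z by apply: sharpE.
have gl a u v z : g (a *: u + v) z = a * g u z + g v z.
  by rewrite g_sym g_linear !(g_sym z).
have gN u v : g (- u) v = - g u v.
  by rewrite /g /metric !mulNmx mxE.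
have gB u v w : g (u - v) w = g u w - g v w.
  by have := gl 1 u (- v) w; rewrite scale1r mul1r gN.
exists nabla; split.
- move=> x a u v; apply: g_nondeg => z.
  by rewrite gl !gn /K (br x) (bl z) !gl !g_linear; field.
- move=> x a u v; apply: g_nondeg => z.
  by rewrite gl !gn /K (br z) (bl x) !gl !g_linear; field.
- move=> x y; apply: g_nondeg => z /=.
  by rewrite gB !gn /K (banti y x) (banti z x) (banti z y) !gN; field.
- move=> x y z; rewrite -!/(g _ _) (g_sym y) !gn /K.
  by rewrite (banti z x) (banti y x) (banti z y) !gN; field.
Qed.

End MetricFacts.

Lemma wedge_dual4 (R : realFieldType) (X : 'M[R]_4) :
  (dual_form (@Ordinal 4 0 isT) \wedge dual_form (@Ordinal 4 1 isT)
     \wedge dual_form (@Ordinal 4 2 isT) \wedge dual_form (@Ordinal 4 3 isT)) X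
  = \det X.
Proof.
have eqw p q (a a' : kform R 4 p) (b b' : kform R 4 q) (Y : 'M_(p + q, 4)) :
    a =1 a' -> b =1 b' -> wedge a b Y = wedge a' b' Y.
  by move=> ea eb; congr (_ * _); apply: eq_bigr => s _; rewrite ea eb.
have dualE (i : 'I_4) : dual_form i =1 (fun Y : 'M[R]_(1, 4) => \det (colsub (fun=> i) Y)).
  by move=> Y; rewrite det_mx11 mxE.
have step p (I : 'I_p -> 'I_4) (a : kform R 4 p) (i : 'I_4) :
    a =1 (fun Y => \det (colsub I Y)) ->
    a \wedge dual_form i =1
      (fun Y => \det (colsub (fun k => if split k is inl l then I l else i) Y)).
  move=> ea Y; rewrite (eqw _ _ _ _ _ _ _ ea (dualE i)) wedge_det.
  congr (\det _); apply/matrixP=> k l; rewrite !mxE.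
  by case: split => c; rewrite mxE.
rewrite (step _ _ _ _ (step _ _ _ _ (step _ _ _ _ (dualE _)))).
congr (\det _); apply/matrixP=> k l; rewrite mxE; congr (X _ _).
case: splitP => [l1 E1|k1 E1]; last by apply: val_inj; rewrite /= E1 ord1.
case: splitP => [l2 E2|k2 E2]; last by apply: val_inj; rewrite /= E1 E2 ord1.
case: splitP => [l3 E3|k3 E3]; last by apply: val_inj; rewrite /= E1 E2 E3 ord1.
by apply: val_inj; rewrite /= E1 E2 E3 ord1.
Qed.

Definition mx_of_rows (R : realFieldType) {m n} (s : seq (seq R)) : 'M[R]_(m, n) :=
  \matrix_(i, j) nth 0 (nth [::] s i) j.

(* delta phi is a 0-form, evaluated at the empty family of vectors.           *)
Definition solves (R : realFieldType) (L : lieAlgebra R 4) (g : 'M[R]_4)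
    (nabla : 'rV[R]_4 -> 'rV[R]_4 -> 'rV[R]_4)
    (phi : kform R 4 1) (H : kform R 4 3) : Prop :=
  [/\ forall x y, ricci L nabla x y + covariant_derivative nabla phi x y
                    - 2^-1 * form_circ g H x y = 0,
      forall X, @codifferential R 4 L g 2 0 erefl H X
                  + contraction (sharp g phi) H X = 0 &
      @codifferential R 4 L g 0 2 erefl phi 0
        + form_inner g phi phi - form_inner g H H = 0].

(* Main.v *)
Require Import Defs.
From mathcomp Require Import all_boot all_order all_algebra.
From mathcomp Require Import reals ring.

Set Implicit Arguments.
Unset Strict Implicit.
Unset Printing Implicit Defensive.

Import Order.TTheory GRing.Theory Num.Theory.
Local Open Scope ring_scope.

(** Write u = e_2 - e_3, a null vector, and l = e^2 + e^3, which is both its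
    metric dual and, up to the factor phi2, the part of phi along e^2, e^3.

    Unimodularity means Tr D = 0 and eliminates d32.  The Levi-Civita connection
    is unique, so it is the explicit one of [levi_civita_conn], and its Ricci
    tensor ([ricci_conn]) has only a few components.  The necessity of the
    normal form comes from three components of the Einstein equation
    ([einstein_forces]).  The one at (e_4, e_4) is 3 d11^2 = 0.  Once d11 = 0,
    the form H is a multiple of d12 + d21, so this sum is non-zero, and the
    components at (e_1, e_2) and (e_2, e_2) read
      (d12 + d21) phi1 = 0   and   d12 (d12 + d21) + d22 phi1 = 0.
    Hence phi1 = d12 = 0, and what survives of phi and H are multiples of phi2
    and d21.

    In the normal form everything degenerates along u
    ([bracket_heisenberg_like], [solves_normal_form]): all brackets are
    multiples of u, phi is phi2 l, and the contraction of H with u vanishes.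
    The forms star phi and star H are killed by u, so both codifferentials
    vanish; phi is parallel and has norm zero; H is a multiple of
    e^1 /\ l /\ e^4, which has norm zero because l is null.  The only equation
    with content is Ric = 1/2 H o H, where both sides are - d21^2/2 times l (x) l.

    Finally the bracket is [x, y] = (x_4 m(y) - y_4 m(x)) u for the covector
    m = d21 e^1 + d22 l, which vanishes on u.  Since d21 is non-zero, the
    functions x_4, m, x_2 are Heisenberg coordinates, and l is the coordinate
    on a complementary central line ([lie_iso_normal_form]). *)

(** * Uniqueness of the Levi-Civita connection *)

(** The difference of two such connections is a tensor A for which g(A(x,y),z)
    is symmetric in x, y and antisymmetric in y, z; a trilinear form with these
    two symmetries vanishes. *)
Lemma levi_civita_unique (R : realFieldType) n (L : lieAlgebra R n)
    (G : 'M[R]_n) nabla nabla' :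
  G^T = G -> G \in unitmx ->
  levi_civita L G nabla -> levi_civita L G nabla' ->
  forall x y, nabla x y = nabla' x y.
Proof.
move=> symG unitG [_ _ tor met] [_ _ tor' met'] x y.
have gC u v : metric G u v = metric G v u.
  rewrite /metric; transitivity ((u *m G *m v^T)^T 0 0); first by rewrite [RHS]mxE.
  by rewrite !trmx_mul trmxK symG mulmxA.
have gBl u v w : metric G (u - v) w = metric G u w - metric G v w.
  by rewrite /metric !mulmxBl !mxE.
pose A u v : 'rV[R]_n := nabla u v - nabla' u v.
have AC u v : A u v = A v u.
  by apply/eqP; rewrite /A -subr_eq0 opprD addrACA -opprD tor tor' subrr.
have AN u v w : metric G (A u v) w = - metric G (A u w) v.
  apply/eqP; rewrite -addr_eq0 !gBl addrACA -opprD.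
  by rewrite (gC (nabla u w)) (gC (nabla' u w)) met met' subrr.
have A0 w : metric G (A x y) w = 0.
  apply/eqP; rewrite -[_ == 0](mulrn_eq0 _ 2) mulr2n.
  by rewrite {1}AN [A x w]AC AN opprK [A w y]AC AN [A y x]AC addNr.
apply/eqP; rewrite -subr_eq0 -/(A x y); 
have/(can_inj (mulmxK unitG))-> // : A x y *m G = 0 *m G.
apply/rowP=> j; rewrite mul0mx [RHS]mxE -(A0 (delta_mx 0 j)) /metric trmx_delta.
by rewrite -colE [RHS]mxE.
Qed.

(** * Coordinates in dimension four *)

(** Indices start at 0, so that the vector e_k of the mathematical comments has
    index o_(k - 1). *)
Definition o0 := @Ordinal 4 0 isT.
Definition o1 := @Ordinal 4 1 isT.
Definition o2 := @Ordinal 4 2 isT.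
Definition o3 := @Ordinal 4 3 isT.

Lemma big_ord4 (V : nmodType) (F : 'I_4 -> V) :
  \sum_i F i = F o0 + F o1 + F o2 + F o3.
Proof.
rewrite !big_ord_recl big_ord0 addr0 !addrA.
by congr (F _ + F _ + F _ + F _); apply: val_inj.
Qed.

Definition row4 {R : realFieldType} (a b c d : R) : 'rV[R]_4 :=
  \row_i nth 0 [:: a; b; c; d] i.

Section Row4.
Variable R : realFieldType.

Lemma row4P (x y : 'rV[R]_4) :
  x 0 o0 = y 0 o0 -> x 0 o1 = y 0 o1 -> x 0 o2 = y 0 o2 -> x 0 o3 = y 0 o3 ->
  x = y.
Proof.
move=> E0 E1 E2 E3; apply/rowP=> -[[|[|[|[|//]]]] lti];
  by rewrite (bool_irrelevance lti isT).
Qed.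

Lemma row4E (x0 x1 x2 x3 : R) :
  (row4 x0 x1 x2 x3 0 o0 = x0) * (row4 x0 x1 x2 x3 0 o1 = x1) *
  (row4 x0 x1 x2 x3 0 o2 = x2) * (row4 x0 x1 x2 x3 0 o3 = x3).
Proof. by rewrite !mxE. Qed.

Lemma row4B (x0 x1 x2 x3 y0 y1 y2 y3 : R) :
  row4 x0 x1 x2 x3 - row4 y0 y1 y2 y3 =
  row4 (x0 - y0) (x1 - y1) (x2 - y2) (x3 - y3).
Proof. by apply: row4P; rewrite !mxE. Qed.

Lemma delta4 :
  (delta_mx 0 o0 = row4 1 0 0 0 :> 'rV[R]_4) *
  (delta_mx 0 o1 = row4 0 1 0 0 :> 'rV[R]_4) *
  (delta_mx 0 o2 = row4 0 0 1 0 :> 'rV[R]_4) *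
  (delta_mx 0 o3 = row4 0 0 0 1 :> 'rV[R]_4).
Proof. by do !split; apply: row4P; rewrite !mxE. Qed.

End Row4.

Lemma col_mx_row0 (R : realFieldType) n (x : 'rV[R]_n) m (Y : 'M[R]_(m, n)) l :
  col_mx x Y (inord 0 : 'I_(m.+1)) l = x 0 l.
Proof.
rewrite -(col_mxEu x Y); congr (col_mx _ _ _ _).
by apply: val_inj; rewrite /= inordK.
Qed.

Lemma col_mx_rowS (R : realFieldType) n (x : 'rV[R]_n) m
    (Y : 'M[R]_(m.+1, n)) a l : (a < m.+1)%N ->
  col_mx x Y (inord a.+1 : 'I_(m.+2)) l = Y (inord a) l.
Proof.
move=> lta; rewrite -(col_mxEd x Y); congr (col_mx _ _ _ _).
by apply: val_inj; rewrite /= !inordK.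
Qed.

(** * Determinants *)

Lemma det2 (R : comNzRingType) (A : 'M[R]_2) :
  let a i j := A (inord i) (inord j) in
  \det A = a 0%N 0%N * a 1%N 1%N - a 0%N 1%N * a 1%N 0%N.
Proof.
move=> a; have aE i j : A i j = a i j by rewrite /a !inord_val.
rewrite (expand_det_row _ 0) !big_ord_recl big_ord0 /cofactor.
by rewrite !det_mx11 !mxE !aE /= /bump /= !addn0 !add0n; ring.
Qed.

Lemma det3 (R : comNzRingType) (A : 'M[R]_3) :
  let a i j := A (inord i) (inord j) in
  \det A = a 0%N 0%N * (a 1%N 1%N * a 2%N 2%N - a 1%N 2%N * a 2%N 1%N)
         - a 0%N 1%N * (a 1%N 0%N * a 2%N 2%N - a 1%N 2%N * a 2%N 0%N)
         + a 0%N 2%N * (a 1%N 0%N * a 2%N 1%N - a 1%N 1%N * a 2%N 0%N).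
Proof.
move=> a; have aE i j : A i j = a i j by rewrite /a !inord_val.
rewrite (expand_det_row _ 0) !big_ord_recl big_ord0 /cofactor.
rewrite !(expand_det_row _ (0 : 'I_2)) !big_ord_recl !big_ord0 /cofactor.
by rewrite !det_mx11 !mxE !aE /= /bump /= !addn0 !add0n; ring.
Qed.

(** Laplace expansion along the first two rows. *)
Lemma det4 (R : comNzRingType) (A : 'M[R]_4) :
  let a i j := A (inord i) (inord j) in
  let m i j := a 2%N i * a 3%N j - a 2%N j * a 3%N i in
  \det A = (a 0%N 0%N * a 1%N 1%N - a 0%N 1%N * a 1%N 0%N) * m 2%N 3%N
         - (a 0%N 0%N * a 1%N 2%N - a 0%N 2%N * a 1%N 0%N) * m 1%N 3%N
         + (a 0%N 0%N * a 1%N 3%N - a 0%N 3%N * a 1%N 0%N) * m 1%N 2%N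
         + (a 0%N 1%N * a 1%N 2%N - a 0%N 2%N * a 1%N 1%N) * m 0%N 3%N
         - (a 0%N 1%N * a 1%N 3%N - a 0%N 3%N * a 1%N 1%N) * m 0%N 2%N
         + (a 0%N 2%N * a 1%N 3%N - a 0%N 3%N * a 1%N 2%N) * m 0%N 1%N.
Proof.
move=> a m; have aE i j : A i j = a i j by rewrite /a !inord_val.
rewrite (expand_det_row _ 0) !big_ord_recl big_ord0 /cofactor !det3.
by rewrite !mxE !aE /= /bump /= !inordK //= !addn0 !add0n /m; ring.
Qed.

Lemma det_col_mx_eq0 (R : comNzRingType) q (u : 'rV[R]_(1 + (1 + q))) r s Z :
  \det (col_mx (r *: u) (col_mx (s *: u) Z)) = 0.
Proof.
pose A1 := col_mx u (col_mx (s *: u) Z); pose A2 := col_mx u (col_mx u Z).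
have -> : \det (col_mx (r *: u) (col_mx (s *: u) Z)) = r * \det A1 + 0 * \det A1.
  apply: (determinant_multilinear (i0 := lshift (1 + q) 0)).
  - by rewrite !rowKu !row_id scale0r addr0.
  - by rewrite !row'Ku ![row' 0 _]flatmx0.
  - by rewrite !row'Ku ![row' 0 _]flatmx0.
have -> : \det A1 = s * \det A2 + 0 * \det A2.
  apply: (determinant_multilinear (i0 := rshift 1 (lshift q 0))).
  - by rewrite !rowKd !rowKu !row_id scale0r addr0.
  - by rewrite !row'Kd !row'Ku ![row' 0 _]flatmx0.
  - by rewrite !row'Kd !row'Ku ![row' 0 _]flatmx0.
rewrite [\det A2](@determinant_alternate _ _ _ (lshift (1 + q) 0) (rshift 1 (lshift q 0))).
- by rewrite !(mulr0, mul0r, addr0).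
- by rewrite eq_lrshift.
- by move=> j; rewrite !(col_mxEu, col_mxEd).
Qed.

(** * Wedge products of coordinate forms *)

Lemma wedge_dual2_det (R : realFieldType) n (i j : 'I_n) (X : 'M[R]_(2, n)) :
  (dual_form i \wedge dual_form j) X =
  \det (colsub (fun c : 'I_2 => nth i [:: i; j] c) X).
Proof.
have dualE (l : 'I_n) :
    dual_form l = (fun Y : 'M[R]_(1, n) => \det (colsub (fun=> l) Y)).
  by apply: boolp.funext => Y; rewrite det_mx11 mxE.
rewrite !dualE wedge_det; congr (\det _); apply/matrixP=> a c; rewrite !mxE.
by case: splitP => k; rewrite ord1 mxE => ->.
Qed.

Lemma wedge2E (R : realFieldType) n (i j : 'I_n) (X : 'M[R]_(2, n)) :
  let x a := X (inord a) in
  (dual_form i \wedge dual_form j) X = x 0%N i * x 1%N j - x 0%N j * x 1%N i.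
Proof. by rewrite wedge_dual2_det det2 !mxE !inordK. Qed.

Lemma wedge3E (R : realFieldType) n (i j k : 'I_n) (X : 'M[R]_(3, n)) :
  let x a := X (inord a) in
  (dual_form i \wedge dual_form j \wedge dual_form k) X =
    x 0%N i * (x 1%N j * x 2%N k - x 1%N k * x 2%N j)
  - x 0%N j * (x 1%N i * x 2%N k - x 1%N k * x 2%N i)
  + x 0%N k * (x 1%N i * x 2%N j - x 1%N j * x 2%N i).
Proof.
move=> x.
have -> : dual_form i \wedge dual_form j =
    (fun Y : 'M[R]_(1 + 1, n) => \det (colsub (fun c : 'I_2 => nth i [:: i; j] c) Y)).
  by apply: boolp.funext => Y; rewrite wedge_dual2_det.
have -> : dual_form k = (fun Y : 'M[R]_(1, n) => \det (colsub (fun=> k) Y)).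
  by apply: boolp.funext => Y; rewrite det_mx11 mxE.
rewrite wedge_det.
transitivity (\det (colsub (fun c : 'I_3 => nth i [:: i; j; k] c) X)).
  congr (\det _); apply/matrixP=> a c; rewrite !mxE.
  case: splitP => d; last by rewrite ord1 mxE => ->.
  by rewrite mxE => ->; case: d => [[|[|//]] ?].
by rewrite det3 !mxE !inordK //= -/(x _) /x; ring.
Qed.

(** * Increasing multi-indices *)

Definition pick2 n (i j : 'I_n) : {ffun 'I_2 -> 'I_n} :=
  [ffun a : 'I_2 => nth i [:: i; j] a].

Definition pick3 n (i j k : 'I_n) : {ffun 'I_3 -> 'I_n} :=
  [ffun a : 'I_3 => nth i [:: i; j; k] a].

Lemma frame_pick2 (R : realFieldType) n (i j : 'I_n) a l : (a < 2)%N ->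
  frame R (pick2 i j) (inord a) l = (nth i [:: i; j] a == l)%:R.
Proof. by move=> lta; rewrite !mxE ffunE inordK. Qed.

Lemma frame_pick3 (R : realFieldType) n (i j k : 'I_n) a l : (a < 3)%N ->
  frame R (pick3 i j k) (inord a) l = (nth i [:: i; j; k] a == l)%:R.
Proof. by move=> lta; rewrite !mxE ffunE inordK. Qed.

Lemma sum_increasing1 (V : nmodType) n (F : ('I_1 -> 'I_n) -> V) :
  \sum_(I : {ffun 'I_1 -> 'I_n} | increasing I) F I =
  \sum_(i : 'I_n) F [ffun=> i].
Proof.
rewrite (reindex (fun i : 'I_n => [ffun=> i] : {ffun 'I_1 -> 'I_n})) /=; last first.
  exists (fun I : {ffun 'I_1 -> 'I_n} => I 0) => [i _|I _]; first by rewrite ffunE.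
  by apply/ffunP=> a; rewrite ffunE (ord1 a).
apply: eq_bigl => i; apply/forallP=> a; apply/forallP=> b.
by rewrite (ord1 a) (ord1 b).
Qed.

Lemma sum_increasing2 (V : nmodType) n (F : ('I_2 -> 'I_n) -> V) :
  \sum_(I : {ffun 'I_2 -> 'I_n} | increasing I) F I =
  \sum_(i : 'I_n) \sum_(j : 'I_n | (i < j)%N) F (pick2 i j).
Proof.
rewrite pair_big_dep /=.
rewrite (reindex (fun p : 'I_n * 'I_n => pick2 p.1 p.2)) /=; last first.
  exists (fun I : {ffun 'I_2 -> 'I_n} => (I ord0, I ord_max)) => [[i j] _|I _] /=.
    by rewrite !ffunE.
  by apply/ffunP=> a; rewrite ffunE; case: a => [[|[|//]] ?] /=; congr (I _); apply: val_inj.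
apply: eq_bigl => -[i j]; apply/forallP/idP => /= [/(_ ord0)/forallP/(_ ord_max)|ij a].
  by rewrite !ffunE.
apply/forallP=> b; rewrite !ffunE.
by case: a b => [[|[|//]] ?] [[|[|//]] ?].
Qed.

Lemma sum_increasing3 (V : nmodType) n (F : ('I_3 -> 'I_n) -> V) :
  \sum_(I : {ffun 'I_3 -> 'I_n} | increasing I) F I =
  \sum_(i : 'I_n) \sum_(j : 'I_n | (i < j)%N) \sum_(k : 'I_n | (j < k)%N)
    F (pick3 i j k).
Proof.
under [RHS]eq_bigr do rewrite pair_big_dep /=.
rewrite pair_big_dep /=.
rewrite (reindex (fun p : 'I_n * ('I_n * 'I_n) =>
   pick3 p.1 p.2.1 p.2.2)) /=; last first.
  exists (fun I : {ffun 'I_3 -> 'I_n} => (I ord0, (I (inord 1), I ord_max))).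
    by move=> [i [j k]] _; rewrite !ffunE inordK.
  move=> I _; apply/ffunP=> a; rewrite ffunE.
  by case: a => [[|[|[|//]]] ?] /=; congr (I _); apply: val_inj; rewrite //= inordK.
apply: eq_bigl => -[i [j k]] /=; apply/forallP/andP => /= [inc|[ij jk] a].
  have := forallP (inc ord0) (inord 1); have := forallP (inc (inord 1)) ord_max.
  by rewrite !ffunE /= !inordK.
apply/forallP=> b; rewrite !ffunE.
by case: a b => [[|[|[|//]]] ?] [[|[|[|//]]] ?] //=; apply: ltn_trans jk.
Qed.

(** * Inner products of forms *)

Lemma invmx_diag_sign (R : realFieldType) n (d : 'rV[R]_n) :
  (forall i, d 0 i * d 0 i = 1) ->
  diag_mx d \in unitmx /\ invmx (diag_mx d) = diag_mx d.
Proof.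
move=> dd; have D1 : diag_mx d *m diag_mx d = 1%:M.
  by rewrite mulmx_diag -diag_const_mx; congr diag_mx; apply/rowP=> i; rewrite !mxE dd.
have [u _] := mulmx1_unit D1; split=> //.
by rewrite -[LHS]mulmx1 -D1 mulKmx.
Qed.

(** The e^I are orthogonal when the e^i are: if the increasing I and J differ,
    look at the first index a where they do; if I a < J a then I a is not a value
    of J, so row a of the minor is zero, and otherwise column a is zero. *)
Lemma form_inner_diag (R : realFieldType) n k (d : 'rV[R]_n) (w w' : kform R n k) :
  (forall i, d 0 i * d 0 i = 1) ->
  form_inner (diag_mx d) w w' =
  \sum_(I : {ffun 'I_k -> 'I_n} | increasing I)
    (\prod_i d 0 (I i)) * (w (frame R I) * w' (frame R I)).
Proof.
move=> dd.
have [_ invd] := invmx_diag_sign dd.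
rewrite /form_inner; apply: eq_bigr => I incI.
rewrite (bigD1 I) //= big1 ?addr0 => [|J /andP[incJ nJI]].
  rewrite mulrC invd; congr (_ * _).
  rewrite -[X in \det X](_ : diag_mx (\row_i d 0 (I i)) = _).
    by rewrite det_diag; apply: eq_bigr => i _; rewrite mxE.
  apply/matrixP=> i j; rewrite !mxE.
  have [->|nij] := eqVneq i j; first by rewrite eqxx.
  case: eqVneq => // Iij; case/eqP: nij; apply: val_inj.
  have [lij|lji|//] := ltngtP i j.
    by have := forallP (forallP incI i) j; rewrite lij Iij ltnn.
  by have := forallP (forallP incI j) i; rewrite lji Iij ltnn.
rewrite invd; suff -> : \det (mxsub I J (diag_mx d)) = 0 by rewrite mulr0.
have lt (K : {ffun 'I_k -> 'I_n}) : increasing K -> forall i j : 'I_k, (i < j -> K i < K j)%N.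
  by move=> /forallP H i j lij; have /forallP/(_ j) := H i; rewrite lij.
have [i nIJ] : exists i, I i != J i.
  apply/existsP; rewrite -negb_forall; apply: contra nJI => /forallP H.
  by apply/eqP/ffunP=> i; rewrite (eqP (H i)).
case: (@arg_minnP _ i (fun i => I i != J i) (fun i => i : nat) nIJ) => a nIJa mina.
have eqIJ (c : 'I_k) : (c < a)%N -> I c = J c.
  by move=> lca; apply/eqP; apply: contraTT lca => /mina; rewrite -leqNgt.
have [lIJ|lJI|/val_inj E] := ltngtP (I a) (J a); last by rewrite E eqxx in nIJa.
- rewrite (expand_det_row _ a) big1 // => c _; rewrite !mxE.
  have [E|_] := eqVneq (I a) (J c); last by rewrite mulr0n mul0r.
  have [lca|lac|/val_inj ca] := ltngtP c a.
  + by have := lt _ incI _ _ lca; rewrite (eqIJ _ lca) E ltnn.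
  + by have := ltn_trans lIJ (lt _ incJ _ _ lac); rewrite E ltnn.
  + by rewrite E ca ltnn in lIJ.
- rewrite (expand_det_col _ a) big1 // => c _; rewrite !mxE.
  have [E|_] := eqVneq (I c) (J a); last by rewrite mulr0n mul0r.
  have [lca|lac|/val_inj ca] := ltngtP c a.
  + by have := lt _ incJ _ _ lca; rewrite -(eqIJ _ lca) E ltnn.
  + by have := ltn_trans lJI (lt _ incI _ _ lac); rewrite E ltnn.
  + by rewrite -E ca ltnn in lJI.
Qed.

Section InnerProducts4.
Variables (R : realFieldType) (d : 'rV[R]_4).
Hypothesis dd : forall i, d 0 i * d 0 i = 1.

Lemma form_inner_diag2 (w w' : kform R 4 2) :
  let p i j := d 0 i * d 0 j * (w (frame R (pick2 i j)) * w' (frame R (pick2 i j))) in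
  form_inner (diag_mx d) w w' =
  p o0 o1 + p o0 o2 + p o0 o3 + p o1 o2 + p o1 o3 + p o2 o3.
Proof.
move=> p; rewrite form_inner_diag //.
pose F (I : 'I_2 -> 'I_4) := (\prod_i d 0 (I i)) * (w (frame R I) * w' (frame R I)).
have FE i j : F (pick2 i j) = p i j.
  by rewrite /F !big_ord_recl big_ord0 !ffunE /= mulr1.
rewrite (sum_increasing2 F) big_ord4 !(big_mkcond (fun j : 'I_4 => _ < _)%N) !big_ord4 /=.
by rewrite ?(addr0, add0r) !addrA !FE.
Qed.

Lemma form_inner_diag3 (w w' : kform R 4 3) :
  let p i j k := d 0 i * d 0 j * d 0 k *
    (w (frame R (pick3 i j k)) * w' (frame R (pick3 i j k))) in
  form_inner (diag_mx d) w w' =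
  p o0 o1 o2 + p o0 o1 o3 + p o0 o2 o3 + p o1 o2 o3.
Proof.
move=> p; rewrite form_inner_diag //.
pose F (I : 'I_3 -> 'I_4) := (\prod_i d 0 (I i)) * (w (frame R I) * w' (frame R I)).
have FE i j k : F (pick3 i j k) = p i j k.
  by rewrite /F /p !big_ord_recl big_ord0 !ffunE /= mulr1 !mulrA.
rewrite (sum_increasing3 F).
under eq_bigr => i _ do under eq_bigr => j _ do
  rewrite (big_mkcond (fun k : 'I_4 => _ < _)%N) big_ord4.
rewrite big_ord4 !(big_mkcond (fun j : 'I_4 => _ < _)%N) !big_ord4 /=.
by rewrite ?(addr0, add0r) !FE.
Qed.

End InnerProducts4.

Lemma frame1 (R : realFieldType) n (i : 'I_n) :
  frame R ([ffun=> i] : {ffun 'I_1 -> 'I_n}) = delta_mx 0 i.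
Proof. by apply/matrixP=> a j; rewrite !mxE ffunE ord1 eqxx eq_sym. Qed.

Lemma form_inner1 (R : realFieldType) n (G : 'M[R]_n) (w w' : kform R n 1) :
  form_inner G w w' =
  \sum_i \sum_j w (delta_mx 0 i) * w' (delta_mx 0 j) * invmx G i j.
Proof.
pose F (I J : 'I_1 -> 'I_n) :=
  w (frame R I) * w' (frame R J) * \det (mxsub I J (invmx G)).
have -> : form_inner G w w' = \sum_(I : {ffun 'I_1 -> 'I_n} | increasing I)
    \sum_(J : {ffun 'I_1 -> 'I_n} | increasing J) F I J by [].
rewrite (sum_increasing1 (fun I => \sum_(J : {ffun 'I_1 -> 'I_n} | increasing J) F I J)).
apply: eq_bigr => i _; rewrite sum_increasing1.
by apply: eq_bigr => j _; rewrite /F !frame1 det_mx11 mxE !ffunE.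
Qed.

(** * Star, differential and codifferential *)

(** The star of a one-form is the contraction of the volume form with the dual
    vector: both sides are expanded along the first row, whose cofactors do not
    depend on that row. *)
Lemma hodge_one_form (R : realFieldType) q (G : 'M[R]_(1 + q)) (w : kform R (1 + q) 1) Y :
  G^T = G -> hodge G (erefl (1 + q)%N) w Y = \det (col_mx (sharp G w) Y).
Proof.
move=> symG; rewrite /hodge form_inner1.
rewrite [RHS](expand_det_row _ (lshift q 0)); apply: eq_bigr => i _.
under eq_bigr => j _ do rewrite castmx_id -mulrA.
rewrite -mulr_sumr mulrC; congr (_ * _).
  rewrite col_mxEu mxE; apply: eq_bigr => j _.
  by rewrite mxE -[in LHS]symG -trmx_inv mxE.
rewrite (expand_det_row _ (lshift q 0)) (bigD1 i) //= big1 => [|j ji]; last first.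
  by rewrite col_mxEu mxE (negPf ji) mul0r.
rewrite col_mxEu mxE !eqxx mul1r addr0.
rewrite /cofactor; congr (_ * \det _); apply/matrixP=> a j; rewrite !mxE.
by case: split_ordP => // k E; case/eqP: (neq_lift (lshift q 0) a); rewrite E (ord1 k).
Qed.

(** In d (star w), every term evaluates star w on a bracket. *)
Lemma codifferential_eq0 (R : realFieldType) n (L : lieAlgebra R n) (G : 'M[R]_n) p q
    (Epq : (p.+1 + q.+1 = n)%N) (w : kform R n p.+1) :
  (forall x y Z, hodge G Epq w (col_mx (L x y) Z) = 0) ->
  forall X, codifferential L G Epq w X = 0.
Proof.
move=> w0 X.
have dw0 Y : chevalley_eilenberg L (hodge G Epq w) Y = 0.
  rewrite /chevalley_eilenberg big1 // => i _.
  by rewrite big1 // => j _; rewrite w0 mulr0.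
rewrite /codifferential [hodge _ _ _ _]big1 ?oppr0 // => I _.
by rewrite big1 // => J _; rewrite dw0 mulr0 mul0r.
Qed.

Lemma chevalley_eilenberg2 (R : realFieldType) n (L : lieAlgebra R n)
    (w : kform R n 2) (X : 'M[R]_(3, n)) :
  let x a := row (inord a) X in
  chevalley_eilenberg L w X =
  - w (col_mx (L (x 0%N) (x 1%N)) (x 2%N)) + w (col_mx (L (x 0%N) (x 2%N)) (x 1%N))
  - w (col_mx (L (x 1%N) (x 2%N)) (x 0%N)).
Proof.
move=> x; rewrite /chevalley_eilenberg !big_ord_recl big_ord0.
rewrite !(big_mkcond (fun j : 'I_2 => _ <= _)%N) !big_ord_recl !big_ord0 /=.
rewrite /bump /= !(addn0, add0n, addr0, add0r) !(expr1, sqrrN, expr1n, mul1r, mulN1r).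
have r0 : row ord0 X = x 0%N.
  by congr (row _ X); apply: val_inj; rewrite /= inordK.
have r1 : row (lift ord0 ord0) X = x 1%N.
  by congr (row _ X); apply: val_inj; rewrite /= inordK.
have r2 : row (lift ord0 (lift ord0 ord0)) X = x 2%N.
  by congr (row _ X); apply: val_inj; rewrite /= inordK.
have r2' : row (lift (lift ord0 ord0) (lift ord0 ord0)) X = x 2%N.
  by congr (row _ X); apply: val_inj; rewrite /= inordK.
have s2 : row' ord0 (row' ord0 X) = x 2%N.
  by apply/rowP=> l; rewrite !mxE; congr (X _ l); apply: val_inj; rewrite /= inordK.
have s1 : row' (lift ord0 ord0) (row' ord0 X) = x 1%N.
  by apply/rowP=> l; rewrite !mxE; congr (X _ l); apply: val_inj; rewrite /= inordK.
have s0 : row' (lift ord0 ord0) (row' (lift ord0 ord0) X) = x 0%N.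
  by apply/rowP=> l; rewrite !mxE; congr (X _ l); apply: val_inj; rewrite /= inordK.
by rewrite r0 r1 r2 r2' s0 s1 s2 -signr_odd expr1 mulN1r.
Qed.

(** * Semidirect products *)

Lemma unimodular_semidirect (R : realFieldType) n (D : 'M[R]_n) :
  unimodular (semidirect D) -> \tr D = 0.
Proof.
move=> /(_ (row_mx 0 1%:M)) <-; rewrite [RHS]big_split_ord /=.
rewrite [X in _ + X]big1 ?addr0 => [|i _]; last by rewrite mxE row_mxEr mxE.
apply: eq_bigr => i _; rewrite [RHS]mxE row_mxEl row_mxKl row_mxKr.
rewrite [1%:M 0 0]mxE eqxx scale1r scaler0 subr0 (_ : lsubmx _ = delta_mx 0 i).
  by rewrite -rowE !mxE.
by apply/rowP=> j; rewrite !mxE eq_shift.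
Qed.

Lemma semidirect_bracket4 (R : realFieldType) (D : 'M[R]_3) (x y : 'rV[R]_4) :
  let v (j : 'I_3) := x 0 o3 * y 0 (lshift 1 j) - y 0 o3 * x 0 (lshift 1 j) in
  semidirect D x y =
  row4 (R := R) (\sum_j D (@Ordinal 3 0 isT) j * v j)
    (\sum_j D (@Ordinal 3 1 isT) j * v j) (\sum_j D (@Ordinal 3 2 isT) j * v j) 0.
Proof.
move=> v; have E3 : rshift 3 (0 : 'I_1) = o3 by apply: val_inj.
have EL k : semidirect_bracket D x y 0 (lshift 1 k) = \sum_j D k j * v j.
  rewrite [LHS]row_mxEl mxE; apply: eq_bigr => j _.
  by rewrite !mxE E3 mulrC.
apply: row4P; rewrite [RHS]mxE /=.
- by rewrite -EL; congr (semidirect_bracket _ _ _ _ _); apply: val_inj.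
- by rewrite -EL; congr (semidirect_bracket _ _ _ _ _); apply: val_inj.
- by rewrite -EL; congr (semidirect_bracket _ _ _ _ _); apply: val_inj.
- by rewrite -E3 [LHS]row_mxEr mxE.
Qed.

(** * The connection and its Ricci tensor *)

Section Geometry.
Variable R : realFieldType.

(** The Gram matrix of the metric is the diagonal matrix with these entries. *)
Definition sig22 : 'rV[R]_4 := row4 1 1 (-1) (-1).

Lemma sig22_sq i : sig22 0 i * sig22 0 i = 1.
Proof. by rewrite mxE; case: i => [[|[|[|[|//]]]] ?] /=; ring. Qed.

Lemma metric_sig22 x y : metric (diag_mx sig22) x y =
  x 0 o0 * y 0 o0 + x 0 o1 * y 0 o1 - x 0 o2 * y 0 o2 - x 0 o3 * y 0 o3.
Proof. by rewrite /metric mul_mx_diag mxE big_ord4 !mxE /=; ring. Qed.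

(** The covector e^2 + e^3, which is null. *)
Definition ell (x : 'rV[R]_4) := x 0 o1 + x 0 o2.

Section UnimodularFamily.
Variables a b c d : R.

(** The family of matrices D after d32 has been eliminated by Tr D = 0. *)
Definition unimodular_D : 'M[R]_3 :=
  mx_of_rows [:: [:: a; b; b]; [:: c; d; - a + d]; [:: - c; - d - 2 * a; - d - a]].

Local Notation L := (semidirect unimodular_D).

(** Obtained from the Koszul formula; its components are polynomials in those of
    x and y, with coefficients linear in the parameters. *)
Definition conn (x y : 'rV[R]_4) : 'rV[R]_4 :=
  let x0 := x 0 o0 in let x1 := x 0 o1 in let x2 := x 0 o2 in let x3 := x 0 o3 in
  let y0 := y 0 o0 in let y1 := y 0 o1 in let y2 := y 0 o2 in let y3 := y 0 o3 in
  row4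
   (y3 * (- a * x0 - 2^-1 * (b + c) * (x1 + x2)) + 2^-1 * (b - c) * x3 * (y1 + y2))
   (y3 * (- 2^-1 * (b + c) * x0 - d * x1 - (2^-1 * a + d) * x2)
      - x3 * (2^-1 * (b - c) * y0 + 3 / 2 * a * y2))
   (y3 * (2^-1 * (b + c) * x0 + (2^-1 * a + d) * x1 + (a + d) * x2)
      + x3 * (2^-1 * (b - c) * y0 - 3 / 2 * a * y1))
   (- a * x0 * y0 - 2^-1 * (b + c) * (x0 * (y1 + y2) + (x1 + x2) * y0)
      - d * x1 * y1 - (2^-1 * a + d) * (x1 * y2 + x2 * y1) - (a + d) * x2 * y2).

Lemma bracket_unimodular_D x y : L x y =
  let v j := x 0 o3 * y 0 j - y 0 o3 * x 0 j in
  row4 (a * v o0 + b * (v o1 + v o2)) (c * v o0 + d * v o1 + (d - a) * v o2)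
       (- c * v o0 - (d + 2 * a) * v o1 - (d + a) * v o2) 0.
Proof.
rewrite semidirect_bracket4 !big_ord_recl !big_ord0 !mxE /=.
have -> : lshift 1 (0 : 'I_3) = o0 by apply: val_inj.
have -> : lshift 1 (lift (0 : 'I_3) 0) = o1 by apply: val_inj.
have -> : lshift 1 (lift (0 : 'I_3) (lift 0 0)) = o2 by apply: val_inj.
by congr row4; ring.
Qed.

Lemma levi_civita_conn : levi_civita L (diag_mx sig22) conn.
Proof.
split=> [x k u v|y k u v|x y|x y z].
- by apply: row4P; rewrite !mxE /=; ring.
- by apply: row4P; rewrite !mxE /=; ring.
- by rewrite bracket_unimodular_D; apply: row4P; rewrite !mxE /=; field.
- by rewrite !metric_sig22 !mxE /=; field.
Qed.

(** For a = 0, where D is nilpotent, only the multiple of ell (x) ell remains;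
    the Einstein equation then compares its coefficient with that of H o H. *)
Lemma ricci_conn x y :
  ricci L conn x y =
  - (3 / 2) * a ^+ 2 * x 0 o3 * y 0 o3
  - (3 / 2) * a * c * (x 0 o0 * ell y + ell x * y 0 o0)
  + (2^-1 * (b ^+ 2 - c ^+ 2) - 3 / 2 * a ^+ 2 - 3 * a * d) * ell x * ell y.
Proof.
have c0 z : conn (delta_mx 0 o0) z = row4 (- a * z 0 o3) (- 2^-1 * (b + c) * z 0 o3)
    (2^-1 * (b + c) * z 0 o3) (- a * z 0 o0 - 2^-1 * (b + c) * (z 0 o1 + z 0 o2)).
  by rewrite delta4 /conn !row4E; congr row4; ring.
have c1 z : conn (delta_mx 0 o1) z = row4 (- 2^-1 * (b + c) * z 0 o3) (- d * z 0 o3)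
    ((2^-1 * a + d) * z 0 o3)
    (- 2^-1 * (b + c) * z 0 o0 - d * z 0 o1 - (2^-1 * a + d) * z 0 o2).
  by rewrite delta4 /conn !row4E; congr row4; ring.
have c2 z : conn (delta_mx 0 o2) z = row4 (- 2^-1 * (b + c) * z 0 o3)
    (- (2^-1 * a + d) * z 0 o3) ((a + d) * z 0 o3)
    (- 2^-1 * (b + c) * z 0 o0 - (2^-1 * a + d) * z 0 o1 - (a + d) * z 0 o2).
  by rewrite delta4 /conn !row4E; congr row4; ring.
have c3 z : conn (delta_mx 0 o3) z = row4 (2^-1 * (b - c) * (z 0 o1 + z 0 o2))
    (- 2^-1 * (b - c) * z 0 o0 - 3 / 2 * a * z 0 o2)
    (2^-1 * (b - c) * z 0 o0 - 3 / 2 * a * z 0 o1) 0.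
  by rewrite delta4 /conn !row4E; congr row4; ring.
rewrite /ricci /mxtrace big_ord4.
do 4! rewrite [lin1_mx _ _ _]mxE.
rewrite /curvature !bracket_unimodular_D !c0 !c1 !c2 !c3 !delta4 !row4E /conn.
by rewrite !row4B !row4E /ell; field.
Qed.

End UnimodularFamily.

(** * The three-form H *)

Local Notation e i := (@dual_form R 4 i).

(** The coefficients on e^124 and e^134 agree, which makes H a multiple of
    e^1 /\ ell /\ e^4 as soon as t = w = 0. *)
Definition threeform (t s w : R) : kform R 4 3 := fun X =>
  t * (e o0 \wedge e o1 \wedge e o2) X
  - s * ((e o0 \wedge e o1 \wedge e o3) X + (e o0 \wedge e o2 \wedge e o3) X)
  + w * (e o1 \wedge e o2 \wedge e o3) X.

Lemma threeformE t s w (X : 'M[R]_(3, 4)) :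
  let m a b c i j k := X a i * (X b j * X c k - X b k * X c j)
     - X a j * (X b i * X c k - X b k * X c i)
     + X a k * (X b i * X c j - X b j * X c i) in
  let m' := m (inord 0) (inord 1) (inord 2) in
  threeform t s w X =
  t * m' o0 o1 o2 - s * (m' o0 o1 o3 + m' o0 o2 o3) + w * m' o1 o2 o3.
Proof. by rewrite /threeform !wedge3E. Qed.

(** The two terms in s cancel because e_2 and e_3 have opposite norms. *)
Lemma form_inner_threeform t s w t' s' w' :
  form_inner (diag_mx sig22) (threeform t s w) (threeform t' s' w') = w * w' - t * t'.
Proof.
rewrite (form_inner_diag3 sig22_sq) !row4E !threeformE !frame_pick3 //=.
by ring.
Qed.

(** Here iij is the component on e^ij, indices from 0, of the contraction of
    the form with v. *)
Lemma form_circ_threeform t s w x y :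
  let i01 v := t * v 0 o2 - s * v 0 o3 in
  let i02 v := - t * v 0 o1 - s * v 0 o3 in
  let i03 v := s * ell v in
  let i12 v := t * v 0 o0 + w * v 0 o3 in
  let i13 v := - s * v 0 o0 - w * v 0 o2 in
  let i23 v := - s * v 0 o0 + w * v 0 o1 in
  form_circ (diag_mx sig22) (threeform t s w) x y =
  i01 x * i01 y - i02 x * i02 y - i03 x * i03 y - i12 x * i12 y
  - i13 x * i13 y + i23 x * i23 y.
Proof.
rewrite /form_circ (form_inner_diag2 sig22_sq) !row4E.
have E i j v : contraction v (threeform t s w) (frame R (pick2 i j)) =
  let d k l := ((k : 'I_4) == l)%:R : R in
  let m p q r := v 0 p * (d i q * d j r - d i r * d j q)
    - v 0 q * (d i p * d j r - d i r * d j p)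
    + v 0 r * (d i p * d j q - d i q * d j p) in
  t * m o0 o1 o2 - s * (m o0 o1 o3 + m o0 o2 o3) + w * m o1 o2 o3.
  by rewrite /contraction threeformE !col_mx_row0 !col_mx_rowS // !frame_pick2.
by rewrite !E /= /ell; ring.
Qed.

(** * Necessity of the normal form *)

(** The three conclusions are the components at (e_4, e_4), (e_1, e_2) and
    (e_2, e_2).  The first involves neither b, c, d nor the one-form, and it
    makes the other two collapse to the stated products. *)
Lemma einstein_forces (a b c d p q r : R) :
  (forall x y,
     ricci (semidirect (unimodular_D a b c d)) (conn a b c d) x y
     + covariant_derivative (conn a b c d)
         (fun X => p * e o0 X + q * (e o1 X + e o2 X) + r * e o3 X) x y
     - 2^-1 * form_circ (diag_mx sig22) (threeform (2 * a) (b + c) (3 * a)) x y = 0) ->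
  [/\ a = 0, (b + c) * r = 0 & b * (b + c) + d * r = 0].
Proof.
move=> ein.
have a0 : a = 0.
  have /eqP : 3 * a ^+ 2 = 0.
    rewrite -(ein (delta_mx 0 o3) (delta_mx 0 o3)) ricci_conn form_circ_threeform.
    rewrite /covariant_derivative /dual_form /conn /ell !delta4 !row4E.
    by field.
  by rewrite mulf_eq0 pnatr_eq0 sqrf_eq0 => /eqP.
rewrite a0 in ein; split=> //.
- have /(congr1 ( *%R 2)) := ein (delta_mx 0 o0) (delta_mx 0 o1).
  rewrite mulr0 => <-; rewrite ricci_conn form_circ_threeform.
  rewrite /covariant_derivative /dual_form /conn /ell !delta4 !row4E.
  by field.
- rewrite -[RHS](ein (delta_mx 0 o1) (delta_mx 0 o1)) ricci_conn form_circ_threeform.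
  rewrite /covariant_derivative /dual_form /conn /ell !delta4 !row4E.
  by field.
Qed.

(** * Sufficiency of the normal form *)

Section NormalForm.
Variables c d q : R.
Local Notation L := (semidirect (unimodular_D 0 0 c d)).
Local Notation g := (diag_mx sig22).

(** The vector e_2 - e_3, metrically dual to [ell]. *)
Definition null_vector : 'rV[R]_4 := row4 0 1 (-1) 0.

Definition bracket_covector (x : 'rV[R]_4) := c * x 0 o0 + d * ell x.

Definition null_one_form : kform R 4 1 := fun X => q * (e o1 X + e o2 X).

(** D has rank one: it is the null vector times the covector, and the covector
    vanishes on the null vector. *)
Lemma bracket_heisenberg_like x y :
  L x y =
  (x 0 o3 * bracket_covector y - y 0 o3 * bracket_covector x) *: null_vector.
Proof.
rewrite bracket_unimodular_D; apply: row4P; rewrite !mxE /= /bracket_covector /ell;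
  by ring.
Qed.

Lemma sharp_null_one_form : sharp g null_one_form = q *: null_vector.
Proof.
have [_ invg] := invmx_diag_sign sig22_sq.
rewrite /sharp invg mul_mx_diag /null_one_form /dual_form.
by apply: row4P; rewrite !mxE /=; ring.
Qed.

(** Only e^124 and e^134 occur in H.  On a vector v, star H picks up -v_3 from
    the first and v_2 from the second, with opposite metric signs; on multiples
    of e_2 - e_3 the two contributions cancel. *)
Lemma hodge_threeform_bracket x y Z :
  hodge g (erefl : (3 + 1 = 4)%N) (threeform 0 c 0) (col_mx (L x y) Z) = 0.
Proof.
rewrite /hodge bracket_heisenberg_like; set k := (_ - _).
rewrite (form_inner_diag3 sig22_sq) !row4E !threeformE !frame_pick3 //=.
set v := k *: null_vector.
pose unit_row (i : 'I_4) : seq R := [seq (i == j)%:R | j <- [:: o0; o1; o2; o3]].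
have E i1 i2 i3 :
    \det (castmx (erefl : (3 + 1 = 4)%N, erefl 4)
            (col_mx (frame R (pick3 i1 i2 i3)) (col_mx v Z))) =
    \det (mx_of_rows [:: unit_row i1; unit_row i2; unit_row i3;
                         [seq v 0 j | j <- [:: o0; o1; o2; o3]]] : 'M[R]_4).
  congr (\det _); apply/matrixP=> i j; rewrite castmx_id [RHS]mxE.
  case: (split_ordP (i : 'I_(3 + 1))) => a ->.
    rewrite [LHS](@col_mxEu _ 3 (1 + 0)) -(inord_val a) frame_pick3 //.
    by case: a j => [[|[|[|//]]] ?] [[|[|[|[|//]]]] ?]; rewrite /= inordK.
  have vE : col_mx v Z 0 j = v 0 j by rewrite -[0 in LHS]inord_val col_mx_row0.
  rewrite [LHS](@col_mxEd _ 3 (1 + 0)) (ord1 a) vE.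
  by case: j {vE} => [[|[|[|[|//]]]] ltj]; rewrite (bool_irrelevance ltj isT).
have v2 : v 0 o2 = - v 0 o1 by rewrite !mxE /=; ring.
by rewrite !E !det4 !mxE !inordK //= v2; ring.
Qed.

Lemma solves_normal_form :
  solves L g (conn 0 0 c d) null_one_form (threeform 0 c 0).
Proof.
have [_ invg] := invmx_diag_sign sig22_sq; split.
- move=> x y; rewrite ricci_conn form_circ_threeform.
  rewrite /covariant_derivative /null_one_form /dual_form !row4E /ell.
  by field.
- move=> X; rewrite codifferential_eq0 ?add0r; last exact: hodge_threeform_bracket.
  rewrite /contraction sharp_null_one_form threeformE !col_mx_row0 !mxE /=.
  by ring.
- rewrite form_inner_threeform form_inner1 invg codifferential_eq0.
    by rewrite !big_ord4 /null_one_form /dual_form !delta4 !mxE /=; ring.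
  (* star phi is the volume form contracted with a multiple of the null vector,
     and brackets are multiples of the same vector. *)
  move=> x y Z; rewrite (@hodge_one_form R 3 g) ?tr_diag_mx //.
  rewrite sharp_null_one_form bracket_heisenberg_like.
  exact: (@det_col_mx_eq0 _ 2).
Qed.

Lemma threeform_exact X :
  threeform 0 c 0 X = chevalley_eilenberg L (e o1 \wedge e o2) X.
Proof.
rewrite chevalley_eilenberg2 !bracket_heisenberg_like !wedge2E threeformE.
rewrite !col_mx_row0 !col_mx_rowS // !mxE /= /bracket_covector /ell !mxE.
by ring.
Qed.

Definition to_heis (x : 'rV[R]_4) : 'rV[R]_(1 + 3) :=
  row4 (ell x) (x 0 o3) (bracket_covector x) (x 0 o1).

Definition of_heis (z : 'rV[R]_(1 + 3)) : 'rV[R]_4 :=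
  row4 (c^-1 * (z 0 o2 - d * z 0 o0)) (z 0 o3) (z 0 o0 - z 0 o3) (z 0 o1).

(** The coordinates [ell], x_4 and [bracket_covector] vanish on the null vector,
    on which x_2 is 1; so x_2 is the coordinate along the derived algebra, and
    [ell] takes no part in any bracket. *)
Lemma lie_iso_normal_form : c != 0 ->
  lie_iso L (direct_sum (abelian_lieAlgebra R 1) (heis3 R)).
Proof.
move=> c0; exists to_heis; split.
- by move=> k x y; apply: row4P; rewrite !mxE /= /bracket_covector /ell ?mxE; ring.
- exists of_heis => x; apply: row4P; rewrite !mxE /= /bracket_covector /ell ?mxE /=;
    by field.
- move=> x y; rewrite bracket_heisenberg_like.
  have El : lshift 3 (0 : 'I_1) = o0 by apply: val_inj.
  apply/rowP=> j; case: (split_ordP (j : 'I_(1 + 3))) => i ->.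
    by rewrite [RHS]row_mxEl (ord1 i) El !mxE /= /ell ?mxE /=; ring.
  rewrite [RHS]row_mxEr !mxE.
  by case: i => [[|[|[|//]]] lti]; rewrite /= /bracket_covector /ell ?mxE /=; ring.
Qed.

End NormalForm.
End Geometry.

(** * The classification *)

Theorem theorem4p18 (R : realType) (d11 d12 d21 d22 d32 phi1 phi2 : R)
    (nabla : 'rV[R]_4 -> 'rV[R]_4 -> 'rV[R]_4) :
  let e1 : kform R 4 1 := dual_form (@Ordinal 4 0 isT) in
  let e2 : kform R 4 1 := dual_form (@Ordinal 4 1 isT) in
  let e3 : kform R 4 1 := dual_form (@Ordinal 4 2 isT) in
  let e4 : kform R 4 1 := dual_form (@Ordinal 4 3 isT) in
  let e23 : kform R 4 2 := e2 \wedge e3 in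
  let e123 : kform R 4 3 := e1 \wedge e2 \wedge e3 in
  let e124 : kform R 4 3 := e1 \wedge e2 \wedge e4 in
  let e134 : kform R 4 3 := e1 \wedge e3 \wedge e4 in
  let e234 : kform R 4 3 := e2 \wedge e3 \wedge e4 in
  let D : 'M[R]_3 := mx_of_rows [:: [:: d11; d12; d12];
                                    [:: d21; d22; - d11 + d22];
                                    [:: - d21; d32; d11 + d32]] in
  let L : lieAlgebra R 4 := semidirect D in
  let g : 'M[R]_4 := mx_of_rows [:: [:: 1; 0; 0; 0];
                                    [:: 0; 1; 0; 0];
                                    [:: 0; 0; -1; 0];
                                    [:: 0; 0; 0; -1]] in
  let phi : kform R 4 1 := fun X =>
    phi1 * e1 X + phi2 * (e2 X + e3 X) + (phi1 + d11 + d22 + d32) * e4 X in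
  let H : kform R 4 3 := fun X =>
    2 * d11 * e123 X - (d12 + d21) * (e124 X + e134 X)
      + (d11 - d22 - d32) * e234 X in
  almost_abelian L ->
  d11 * \tr D = 0 ->
  d11 * phi1 = 0 ->
  d12 * phi1 + (d22 + d32) * phi2 = 0 ->
  unimodular L ->
  ~ (forall X, phi X = 0) ->
  ~ (forall X, H X = 0) ->
  levi_civita L g nabla ->
  (solves L g nabla phi H <->
   [/\ D = mx_of_rows [:: [:: 0; 0; 0];
                          [:: d21; d22; d22];
                          [:: - d21; - d22; - d22]],
       forall X, phi X = phi2 * (e2 X + e3 X),
       (forall X, H X = - d21 * (e124 X + e134 X)) /\
       (forall X, H X = chevalley_eilenberg L e23 X),
       phi2 != 0 &
       d21 != 0])
  /\ (solves L g nabla phi H ->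
      lie_iso L (direct_sum (abelian_lieAlgebra R 1) (heis3 R))).
Proof.
move=> e1 e2 e3 e4 e23 e123 e124 e134 e234 D L g phi H.
move=> _ _ _ _ uni phi_neq0 H_neq0 lc.
have d32E : d32 = - d22 - 2 * d11.
  have := @unimodular_semidirect R 3 D uni.
  rewrite /mxtrace !big_ord_recl big_ord0 !mxE /= => tr0.
  by apply/eqP; rewrite -subr_eq0; apply/eqP; rewrite -[RHS]tr0; ring.
have DE : D = unimodular_D d11 d12 d21 d22.
  by apply/matrixP=> -[[|[|[|//]]] ?] [[|[|[|//]]] ?]; rewrite !mxE //= d32E; ring.
have gE : g = diag_mx (sig22 R).
  by apply/matrixP=> -[[|[|[|[|//]]]] ?] [[|[|[|[|//]]]] ?]; rewrite !mxE.
have LE : L = semidirect (unimodular_D d11 d12 d21 d22) by rewrite /L DE.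
rewrite LE gE in lc *.
have -> : nabla = conn d11 d12 d21 d22.
  apply: boolp.funext => x; apply: boolp.funext => y.
  have [unit_g _] := invmx_diag_sign (@sig22_sq R).
  exact: levi_civita_unique (tr_diag_mx _) unit_g lc (levi_civita_conn _ _ _ _) x y.
have fwd : solves (semidirect (unimodular_D d11 d12 d21 d22)) (diag_mx (sig22 R))
    (conn d11 d12 d21 d22) phi H -> 
  [/\ d11 = 0, d12 = 0, phi1 = 0, phi2 != 0 & d21 != 0].
  case=> ein _ _.
  have w3 : d11 - d22 - d32 = 3 * d11 by rewrite d32E; ring.
  have := @einstein_forces R d11 d12 d21 d22 phi1 phi2 (phi1 + d11 + d22 + d32).
  rewrite -w3 => /(_ ein) [a0 s0 b0].
  have r0 : phi1 + d11 + d22 + d32 = phi1 by rewrite d32E a0; ring.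
  rewrite r0 in s0 b0.
  have s_neq0 : d12 + d21 != 0.
    apply/eqP=> s0'; apply: H_neq0 => X.
    by rewrite /H w3 s0' a0; ring.
  move/eqP: s0; rewrite mulf_eq0 (negPf s_neq0) /= => /eqP p0.
  move/eqP: b0; rewrite p0 mulr0 addr0 mulf_eq0 (negPf s_neq0) orbF => /eqP b0.
  split=> //; last by rewrite b0 add0r in s_neq0.
  apply/eqP=> q0; apply: phi_neq0 => X.
  by rewrite /phi r0 p0 q0; ring.
split; last first.
  case/fwd=> -> -> _ _ c0; exact: lie_iso_normal_form.
split=> [/fwd[a0 b0 p0 q0 c0]|[D0 phiE [HE _] q0 c0]].
- have d32N : d32 = - d22 by rewrite d32E a0; ring.
  have HE X : H X = threeform 0 d21 0 X.
    by rewrite /H /threeform a0 b0 d32N -!/(e123 X) -!/(e124 X) -!/(e134 X); ring.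
  split=> //.
  + by rewrite /D a0 b0 d32N !(oppr0, add0r).
  + by move=> X; rewrite /phi p0 a0 d32N; ring.
  + split=> X; last by rewrite HE (threeform_exact _ d22) a0 b0.
    by rewrite /H a0 b0 d32N; ring.
- have a0 : d11 = 0 by have /matrixP/(_ 0 0) := D0; rewrite !mxE.
  have b0 : d12 = 0 by have /matrixP/(_ 0 1) := D0; rewrite !mxE.
  have p0 : phi1 = 0.
    have := phiE (delta_mx 0 o0); rewrite /phi /e1 /e2 /e3 /e4 /dual_form !mxE /=.
    by rewrite !(mulr0, addr0, mulr1).
  have -> : phi = null_one_form phi2 by apply: boolp.funext.
  have -> : H = threeform 0 d21 0.
    by apply: boolp.funext => X; rewrite HE /threeform -!/(e124 X) -!/(e134 X); ring.
  rewrite a0 b0; exact: solves_normal_form.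
Qed.
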